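(* Define $\xi:[\frac12,1]\to[0,2]$ by $$\xi(\gamma)=2-\log_2\gamma-\frac1\gamma\sum_{k=1}^\infty\frac{k\,\varepsilon_k}{2^k},$$ where $(\varepsilon_k)_{k\ge0}\subseteq\{0,1\}$ is the sequence of digits of the dyadic expansion $\gamma=\sum_{k=0}^\infty\frac{\varepsilon_k}{2^k}$ of $\gamma$, chosen such that $\varepsilon_k=0$ for infinitely many $k$. Then the range $\xi([\frac12,1])=\{\xi(\gamma):\gamma\in[\frac12,1]\}$ is equal to the interval $(0,2]$, and hence $$\dim_{\rm H}\xi([\tfrac12,1])=\dim_{\rm B}\xi([\tfrac12,1])=1.$$
   Context: $\dim_{\rm H}$ denotes Hausdorff dimension. For a bounded set $F\subseteq\mathbb{R}^d$ let $N_\delta(F)$ be the smallest number of closed balls of radius $\delta$ that cover $F$; the box-counting dimension is $\dim_{\rm B}F=\lim_{\delta\to0}\frac{\log N_\delta(F)}{-\log\delta}$, provided the limit exists. $\log_2$ is the logarithm to base $2$. For $\gamma=1$ the digits are $\varepsilon_0=1$ and $\varepsilon_k=0$ for $k\ge1$; for $\gamma\in[\frac12,1)$ one has $\varepsilon_0=0$ and $\varepsilon_1=1$. *)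

(* Defs.v *)
From HB Require Import structures.
From mathcomp Require Import all_boot all_order all_algebra.
From mathcomp Require Import all_classical all_reals all_analysis.

Set Implicit Arguments.
Unset Strict Implicit.
Unset Printing Implicit Defensive.

Import Order.TTheory GRing.Theory Num.Theory.
Import numFieldNormedType.Exports.

Local Open Scope classical_set_scope.
Local Open Scope ring_scope.

Definition log2 {R : realType} (x : R) : R := ln x / ln 2.

(* Digits are booleans, read as 0 and 1 in R.  The second clause selects the
   terminating expansion when there are two. *)
Definition dyadic_expansion {R : realType} (x : R) (e : nat -> bool) : Prop :=
  series (fun k => (e k)%:R / 2 ^+ k : R) @ \oo --> x
  /\ infinite_set [set k | e k = false].

(* Every x in [0, 2[ has exactly one expansion in the above sense; the default
   value of xget is used only for x outside [0, 2[. *)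
Definition dyadic_digits {R : realType} (x : R) : nat -> bool :=
  xget (fun=> false) (dyadic_expansion x).

(* Only the values of xi on [1/2, 1] are meaningful. *)
Definition xi {R : realType} (g : R) : R :=
  2 - log2 g
  - g^-1 * limn (fun n => \sum_(1 <= k < n.+1)
                            (k%:R * (dyadic_digits g k)%:R / 2 ^+ k : R)).

Section Dimensions.
Context {R : realType} {V : normedModType R}.
Implicit Types (F U : set V) (s l delta : R).

(* The diameter of the empty set is -oo here; see diameter_pow. *)
Definition diameter U : \bar R :=
  ereal_sup [set `|x - y|%:E | x in U & y in U].

(* The empty set has weight 0 for every s, including s = 0, so that a finite
   cover can be padded into a sequence at no cost. *)
Definition diameter_pow s U : \bar R :=
  if U == set0 then 0%E else (diameter U `^ s)%E.

Definition hausdorff_premeasure s delta F : \bar R :=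
  ereal_inf [set (\sum_(0 <= i <oo) diameter_pow s (U i))%E
            | U in [set U : (set V)^nat |
                     F `<=` \bigcup_i U i /\
                     forall i, (diameter (U i) <= delta%:E)%E]].

(* The premeasure is nonincreasing in delta, so the supremum over delta > 0 is
   its limit as delta tends to 0. *)
Definition hausdorff_measure s F : \bar R :=
  ereal_sup [set hausdorff_premeasure s delta F
            | delta in [set delta : R | 0 < delta]].

Definition hausdorff_dim F : \bar R :=
  ereal_inf [set s%:E | s in [set s : R | 0 <= s /\
                                hausdorff_measure s F = 0%E]].

Definition ball_coverable F delta (n : nat) : Prop :=
  exists c : nat -> V, F `<=` \bigcup_(i < n) closed_ball (c i) delta.

(* A nonempty set of natural numbers contains its infimum; for bounded F in
   finite dimension and delta > 0 the set below is nonempty. *)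
Definition covering_number F delta : R :=
  inf [set n%:R | n in [set n : nat | ball_coverable F delta n]].

(* The limit exists and equals l. *)
Definition has_box_dim F l : Prop :=
  bounded_set F /\
  (ln (covering_number F delta) / - ln delta) @[delta --> 0^'+] --> l.

End Dimensions.

(* Main.v *)
(** Let S_j(x) be the j-th partial sum of the dyadic expansion of x and
f(x) = sum_k k e_k / 2^k, so that xi(x) = 2 - log2 x - f(x) / x.  Summation by
parts gives f(x) = sum_j (x - S_j(x)).  As S_j is nondecreasing in x and
x - S_j(x) <= 2^-j, for x <= y the increment f(y) - f(x) is at most
m (y - x) + 2 / 2^m for every m.  Thus f can jump only downwards and xi only
upwards, which is enough for the intermediate value property.  On [1/2, 1[ one
has x <= f(x) <= 2 x, hence 0 < xi <= 2, while xi(1/2) = 2 and xi tends to 0 at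
1 from the left; so xi takes every value in ]0, 2].  Both dimensions of ]0, 2]
follow by comparing covers with Lebesgue measure. *)

Require Import Defs.
From mathcomp Require Import all_boot all_order all_algebra.
From mathcomp Require Import all_classical all_reals all_analysis.
From mathcomp Require Import ring lra.
Import Order.TTheory GRing.Theory Num.Theory.
Import numFieldNormedType.Exports.
Local Open Scope classical_set_scope.
Local Open Scope ring_scope.
Set Implicit Arguments.
Unset Strict Implicit.
Unset Printing Implicit Defensive.

(** * Finite and infinite sets of natural numbers *)

Lemma finite_set_nat_bound (A : set nat) :
  finite_set A -> exists n, forall k, A k -> (k <= n)%N.
Proof.
move=> finA; exists (\max_(i <- finmap.enum_fset (fset_set A)) i)%N => k Ak.
by apply: (@leq_bigmax_seq _ _ predT id) => //; rewrite in_fset_set// inE.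
Qed.

Lemma infinite_set_nat_ex (A : set nat) (n : nat) :
  infinite_set A -> exists2 k, A k & (n < k)%N.
Proof.
move=> infA; apply: contrapT => noA; apply: infA.
apply: (sub_finite_set _ (finite_II n.+1)) => k Ak /=.
by rewrite ltnNge; apply/negP => nk; apply: noA; exists k.
Qed.

(** * Dyadic expansions: existence, error bounds and monotonicity *)

Section DyadicExpansions.
Variable R : realType.
Implicit Types (x y : R) (e : nat -> bool) (n m : nat).

Definition dyadic_psum e n : R := \sum_(0 <= k < n.+1) (e k)%:R / 2 ^+ k.

Lemma dyadic_psumS e n :
  dyadic_psum e n.+1 = dyadic_psum e n + (e n.+1)%:R / 2 ^+ n.+1.
Proof. by rewrite /dyadic_psum big_nat_recr. Qed.

Lemma dyadic_psum0 e : dyadic_psum e 0 = (e 0%N)%:R.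
Proof. by rewrite /dyadic_psum big_nat1 expr0 divr1. Qed.

Lemma le_dyadic_psum e n m : (n <= m)%N -> dyadic_psum e n <= dyadic_psum e m.
Proof.
elim: m => [|m IH]; first by rewrite leqn0 => /eqP ->.
rewrite leq_eqVlt ltnS => /predU1P[->//|/IH /le_trans]; apply.
by rewrite dyadic_psumS lerDl divr_ge0// exprn_ge0.
Qed.

Lemma exp2V_gt0 n : 0 < (2 ^+ n : R)^-1.
Proof. by rewrite invr_gt0 exprn_gt0. Qed.

Lemma exp2VS n : (2 ^+ n : R)^-1 = 2 * (2 ^+ n.+1)^-1.
Proof. by rewrite exprS invfM mulrA divff ?mul1r. Qed.

(** The dyadic intervals of length [2^-n] starting at the partial sums are nested: a new digit moves
    the left end by at most half the length. *)
Lemma dyadic_psum_tail_le e n m : (n <= m)%N ->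
  dyadic_psum e m + (2 ^+ m)^-1 <= dyadic_psum e n + (2 ^+ n)^-1.
Proof.
elim: m => [|m IH]; first by rewrite leqn0 => /eqP ->.
rewrite leq_eqVlt ltnS => /predU1P[->//|/IH]; apply: le_trans.
rewrite dyadic_psumS (exp2VS m); have := exp2V_gt0 m.+1.
by case: (e m.+1) => /=; lra.
Qed.

Lemma cvg_exp2V : (2 ^+ n : R)^-1 @[n --> \oo] --> (0 : R).
Proof.
under eq_fun do rewrite -exprVn.
by apply: cvg_expr; rewrite ger0_norm ?invr_ge0// invf_lt1 ?ltr1n.
Qed.

Lemma dyadic_expansion_cvg_psum x e : dyadic_expansion x e ->
  dyadic_psum e n @[n --> \oo] --> x.
Proof. by move=> [+ _]; rewrite -cvg_shiftS. Qed.

Lemma dyadic_expansion_bounds x e n : dyadic_expansion x e ->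
  dyadic_psum e n <= x < dyadic_psum e n + (2 ^+ n)^-1.
Proof.
move=> xe; have cvgx := dyadic_expansion_cvg_psum xe.
apply/andP; split.
  apply: (cvgr_to_ge cvgx).
  by exists n => // m /= nm; exact: le_dyadic_psum.
(* A zero digit beyond [n] makes the upper bound strict: there the sum stays put while the interval
   is halved. *)
have [k /= ek nk] := infinite_set_nat_ex n xe.2.
case: k ek nk => // k ek nk.
have xle : x <= dyadic_psum e k.+1 + (2 ^+ k.+1)^-1.
  have cvg2 : dyadic_psum e n + (2 ^+ n)^-1 @[n --> \oo] --> x + 0.
    by apply: cvgD => //; exact: cvg_exp2V.
  rewrite -[x]addr0; apply: (cvgr_to_le cvg2).
  by exists k.+1 => // m /= km; exact: dyadic_psum_tail_le.
rewrite dyadic_psumS ek mul0r addr0 in xle.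
have : dyadic_psum e k + (2 ^+ k)^-1 <= dyadic_psum e n + (2 ^+ n)^-1.
  exact: dyadic_psum_tail_le.
by rewrite (exp2VS k); have := exp2V_gt0 k.+1; lra.
Qed.

Lemma dyadic_psum_natE e n : exists N : nat, dyadic_psum e n = N%:R / 2 ^+ n.
Proof.
elim: n => [|n [N IH]]; first by exists (e 0%N); rewrite dyadic_psum0 expr0 divr1.
exists (2 * N + e n.+1)%N; rewrite dyadic_psumS IH (exp2VS n) natrD natrM; ring.
Qed.

(** Both sums are integer multiples [N / 2^n] and [N' / 2^n], and
    [N / 2^n <= x <= y < (N' + 1) / 2^n] forces [N <= N']. *)
Lemma le_dyadic_psum_expansion x y e e' n : x <= y ->
  dyadic_expansion x e -> dyadic_expansion y e' ->
  dyadic_psum e n <= dyadic_psum e' n.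
Proof.
move=> xy /dyadic_expansion_bounds-/(_ n)/andP[lex _].
move=> /dyadic_expansion_bounds-/(_ n)/andP[_ lty].
have [N eN] := dyadic_psum_natE e n; have [N' eN'] := dyadic_psum_natE e' n.
have : dyadic_psum e n < dyadic_psum e' n + (2 ^+ n)^-1 by lra.
rewrite eN eN' -[X in _ + X]mul1r -mulrDl ltr_pM2r ?exp2V_gt0// -natr1.
by rewrite ler_pM2r ?exp2V_gt0// ler_nat natr1 ltr_nat ltnS.
Qed.

Definition floor_digits x n : bool := odd (Num.truncn (x * 2 ^+ n)).

Lemma truncn_double x : 0 <= x ->
  Num.truncn (x * 2) = (odd (Num.truncn (x * 2)) + 2 * Num.truncn x)%N.
Proof.
move=> x0; have : 0 <= x * 2 by lra.
move=> /truncn_itv; set N := Num.truncn (x * 2) => N2.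
suff -> : Num.truncn x = N./2 by rewrite mul2n odd_double_half.
apply: truncn_def; move: N2; rewrite -{1 2}(odd_double_half N) -mul2n.
have b0 : (0 : R) <= (odd N)%:R by rewrite ler0n.
have b1 : (odd N)%:R <= (1 : R) by rewrite lern1 leq_b1.
by rewrite -!natr1 natrD natrM; lra.
Qed.

(** Doubling appends the parity bit to the integer part; [x < 2] makes the initial integer part a
    single bit. *)
Lemma dyadic_psum_floor_digits x n : 0 <= x < 2 ->
  dyadic_psum (floor_digits x) n = (Num.truncn (x * 2 ^+ n))%:R / 2 ^+ n.
Proof.
move=> /andP[x0 x2]; elim: n => [|n IH].
  rewrite dyadic_psum0 /floor_digits expr0 mulr1 divr1.
  have : (Num.truncn x < 2)%N by rewrite truncn_lt_nat.
  by case: (Num.truncn x) => [|[|]].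
rewrite dyadic_psumS IH /floor_digits exprSr mulrA.
rewrite [in RHS]truncn_double ?mulr_ge0 ?exprn_ge0//.
by rewrite natrD natrM -exprSr (exp2VS n); ring.
Qed.

Lemma floor_digits_expansion x : 0 <= x < 2 ->
  dyadic_expansion x (floor_digits x).
Proof.
move=> x02; have /andP[x0 _] := x02.
have bnd n : dyadic_psum (floor_digits x) n <= x
    < dyadic_psum (floor_digits x) n + (2 ^+ n)^-1.
  rewrite dyadic_psum_floor_digits// -[X in _ + X]mul1r -mulrDl natr1.
  rewrite ler_pdivrMr ?exprn_gt0// ltr_pdivlMr ?exprn_gt0//.
  by apply: truncn_itv; rewrite mulr_ge0// exprn_ge0.
split.
  rewrite -cvg_shiftS.
  have lim0 : x - (2 ^+ n)^-1 @[n --> \oo] --> x.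
    by rewrite -[X in _ --> X]subr0; apply: cvgB; [exact: cvg_cst|exact: cvg_exp2V].
  apply: (squeeze_cvgr _ lim0 (cvg_cst _)).
  by near=> n; have /andP[h1 h2] := bnd n; apply/andP; split => //;
     rewrite /series/= -/(dyadic_psum _ n); lra.
(* If all digits after [N] were 1, the right ends of the dyadic intervals would be constant from [N]
   on. Each is at most [x + 2^-n], so the constant is at most [x], against the strict bound at
   [N]. *)
move=> /finite_set_nat_bound[N digN].
have ones n : (N <= n)%N -> dyadic_psum (floor_digits x) n + (2 ^+ n)^-1
    = dyadic_psum (floor_digits x) N + (2 ^+ N)^-1.
  elim: n => [|n IH]; first by rewrite leqn0 => /eqP ->.
  rewrite leq_eqVlt => /predU1P[->//|]; rewrite ltnS => Nn.
  rewrite -IH// dyadic_psumS (exp2VS n).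
  have -> : floor_digits x n.+1 = true.
    by apply/negPn/negP => /negbTE /digN; rewrite ltnNge Nn.
  by rewrite /=; lra.
have /andP[_ ltx] := bnd N.
have : dyadic_psum (floor_digits x) N + (2 ^+ N)^-1 <= x + 0.
  have cvg2 : x + (2 ^+ n)^-1 @[n --> \oo] --> x + 0.
    by apply: cvgD; [exact: cvg_cst|exact: cvg_exp2V].
  apply: (cvgr_to_ge cvg2).
  exists N => // n /= Nn; rewrite -(ones n Nn).
  by have /andP[+ _] := bnd n; lra.
by lra.
Unshelve. all: by end_near.
Qed.

Lemma dyadic_digits_expansion x : 0 <= x < 2 ->
  dyadic_expansion x (dyadic_digits x).
Proof.
by move=> x02; apply: xgetPex; exists (floor_digits x);
  exact: floor_digits_expansion.
Qed.

End DyadicExpansions.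

(** * The weighted digit sum: modulus, bounds and special values *)

Section WeightedDigitSum.
Variable R : realType.
Implicit Types (x y : R) (e : nat -> bool) (n m : nat).

Definition weighted_psum e n : R :=
  \sum_(1 <= k < n.+1) (k%:R * (e k)%:R / 2 ^+ k).

Lemma weighted_psum0 e : weighted_psum e 0 = 0.
Proof. by rewrite /weighted_psum big_geq. Qed.

Lemma weighted_psumS e n : weighted_psum e n.+1 =
  weighted_psum e n + n.+1%:R * ((e n.+1)%:R / 2 ^+ n.+1).
Proof. by rewrite /weighted_psum big_nat_recr//= mulrA. Qed.

(* Summation by parts: each term k e_k / 2^k is counted once for every j < k. *)
Lemma weighted_psumE e n : weighted_psum e n =
  \sum_(0 <= j < n) (dyadic_psum R e n - dyadic_psum R e j).
Proof.
elim: n => [|n IH]; first by rewrite weighted_psum0 big_geq.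
rewrite weighted_psumS IH; under [in RHS]eq_bigr do rewrite dyadic_psumS addrAC.
rewrite [RHS]big_split/= [in RHS]big_nat_recr//= subrr addr0; congr (_ + _).
by rewrite sumr_const_nat subn0 mulr_natl.
Qed.

Lemma sum_exp2V m n : (m <= n)%N ->
  \sum_(m <= j < n) (2 ^+ j : R)^-1 = 2 * (2 ^+ m)^-1 - 2 * (2 ^+ n)^-1.
Proof.
elim: n => [|n IH]; first by rewrite leqn0 => /eqP ->; rewrite big_geq// subrr.
rewrite leq_eqVlt => /predU1P[->|]; first by rewrite big_geq// subrr.
by rewrite ltnS => mn; rewrite big_nat_recr//= IH// (exp2VS R n); ring.
Qed.

Lemma le_weighted_psum e n m : (n <= m)%N ->
  weighted_psum e n <= weighted_psum e m.
Proof.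
elim: m => [|m IH]; first by rewrite leqn0 => /eqP ->.
rewrite leq_eqVlt ltnS => /predU1P[->//|/IH /le_trans]; apply.
by rewrite weighted_psumS lerDl mulr_ge0// divr_ge0// exprn_ge0.
Qed.

Lemma dyadic_psumB_le e j n : (j <= n)%N ->
  dyadic_psum R e n - dyadic_psum R e j <= (2 ^+ j)^-1.
Proof.
by move=> /(@dyadic_psum_tail_le R e j n); have := exp2V_gt0 R n; lra.
Qed.

Lemma weighted_psum_le2 e n : weighted_psum e n <= 2.
Proof.
rewrite weighted_psumE.
apply: (@le_trans _ _ (\sum_(0 <= j < n) (2 ^+ j)^-1)).
  by apply: ler_sum_nat => j /andP[_ jn]; apply: dyadic_psumB_le; exact: ltnW.
by rewrite sum_exp2V// expr0; have := exp2V_gt0 R n; lra.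
Qed.

Definition weighted_digit_sum x : R :=
  limn (weighted_psum (dyadic_digits x)).

Lemma cvg_weighted_psum x :
  weighted_psum (dyadic_digits x) n @[n --> \oo] --> weighted_digit_sum x.
Proof.
apply: nondecreasing_is_cvgn; first by move=> n m; exact: le_weighted_psum.
by exists 2 => _ [n _ <-]; exact: weighted_psum_le2.
Qed.

(* The partial sums of x and y > x lie in the same order, so the j-th term of
   [weighted_psumE] grows by at most y - x, and it never exceeds 2^-j. *)
Lemma weighted_digit_sum_mod x y m : 0 <= x -> x <= y -> y < 2 ->
  weighted_digit_sum y - weighted_digit_sum x
  <= m%:R * (y - x) + 2 * (2 ^+ m)^-1.
Proof.
move=> x0 xy y2.
have xe : dyadic_expansion x (dyadic_digits x).
  by apply: dyadic_digits_expansion; lra.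
have ye : dyadic_expansion y (dyadic_digits y).
  by apply: dyadic_digits_expansion; lra.
set e := dyadic_digits x in xe; set e' := dyadic_digits y in ye.
(* The correction pays for replacing [x] by its [n]-th partial sum in the first [m] terms, an error
   below [2^-n] each, and vanishes in the limit. *)
have lim : weighted_psum e' n - weighted_psum e n - m%:R * (2 ^+ n)^-1
    @[n --> \oo] --> weighted_digit_sum y - weighted_digit_sum x - m%:R * 0.
  apply: cvgB; first by apply: cvgB; exact: cvg_weighted_psum.
  by apply: cvgM; [exact: cvg_cst|exact: cvg_exp2V].
rewrite mulr0 subr0 in lim; apply: (cvgr_to_le lim); exists m => // n /= mn.
rewrite !weighted_psumE -sumrB (big_cat_nat (n := m))//=.
have : \sum_(0 <= j < m) (dyadic_psum R e' n - dyadic_psum R e' j -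
    (dyadic_psum R e n - dyadic_psum R e j))
    <= m%:R * (y - x) + m%:R * (2 ^+ n)^-1.
  rewrite -mulrDr -[m in m%:R]subn0 mulr_natl -sumr_const_nat.
  apply: ler_sum_nat => j _.
  have := le_dyadic_psum_expansion j xy xe ye.
  have /andP[_] := dyadic_expansion_bounds n xe.
  have /andP[+ _] := dyadic_expansion_bounds n ye.
  move: (dyadic_psum R e n) (dyadic_psum R e j) => p q.
  by move: (dyadic_psum R e' n) (dyadic_psum R e' j) => p' q'; lra.
have : \sum_(m <= j < n) (dyadic_psum R e' n - dyadic_psum R e' j -
    (dyadic_psum R e n - dyadic_psum R e j))
    <= 2 * (2 ^+ m)^-1 - 2 * (2 ^+ n)^-1.
  rewrite -sum_exp2V//; apply: ler_sum_nat => j /andP[_ /ltnW jn].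
  apply: le_trans (dyadic_psumB_le e' jn); rewrite gerBl subr_ge0.
  exact: le_dyadic_psum.
by have := exp2V_gt0 R n; lra.
Qed.

Lemma dyadic_psum_lt1 x e n : x < 1 -> dyadic_expansion x e ->
  dyadic_psum R e n <= 1 - (2 ^+ n)^-1.
Proof.
move=> x1 /dyadic_expansion_bounds-/(_ n)/andP[ltx _].
have [N eN] := dyadic_psum_natE R e n; rewrite eN in ltx *.
have : N%:R / 2 ^+ n < (1 : R) by lra.
rewrite ltr_pdivrMr ?exprn_gt0// mul1r -natrX ltr_nat => N2.
rewrite lerBrDr -[X in _ + X]mul1r -mulrDl natr1 ler_pdivrMr ?exprn_gt0//.
by rewrite mul1r ler_nat.
Qed.

(** By [dyadic_psum_lt1], [x - S_j >= 2^-j - (1 - x)]; only the terms [j < m] are kept. Letting [x]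
    tend to 1 and then [m] to infinity, the bound tends to 2. *)
Lemma weighted_digit_sum_ge x m : 0 <= x -> x < 1 ->
  2 - 2 * (2 ^+ m)^-1 - m%:R * (1 - x) <= weighted_digit_sum x.
Proof.
move=> x0 x1; have xe : dyadic_expansion x (dyadic_digits x).
  by apply: dyadic_digits_expansion; lra.
have lim : weighted_psum (dyadic_digits x) n + m%:R * (2 ^+ n)^-1
    @[n --> \oo] --> weighted_digit_sum x + m%:R * 0.
  apply: cvgD; first exact: cvg_weighted_psum.
  by apply: cvgM; [exact: cvg_cst|exact: cvg_exp2V].
rewrite mulr0 addr0 in lim; apply: (cvgr_to_ge lim); exists m => // n /= mn.
rewrite weighted_psumE (big_cat_nat (n := m))//=.
set e := dyadic_digits x in xe *.
have : \sum_(0 <= j < m) (2 ^+ j)^-1 - m%:R * (1 - x) - m%:R * (2 ^+ n)^-1 <=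
    \sum_(0 <= j < m) (dyadic_psum R e n - dyadic_psum R e j).
  have -> (t : R) : t - m%:R * (1 - x) - m%:R * (2 ^+ n)^-1 =
      t - \sum_(0 <= j < m) (1 - x + (2 ^+ n)^-1).
    by rewrite sumr_const_nat subn0 -mulr_natl; ring.
  rewrite -sumrB; apply: ler_sum_nat => j _.
  have := dyadic_psum_lt1 j x1 xe.
  by have /andP[_] := dyadic_expansion_bounds n xe; lra.
have : 0 <= \sum_(m <= j < n) (dyadic_psum R e n - dyadic_psum R e j).
  rewrite big_nat sumr_ge0// => j /andP[_ /ltnW jn].
  by rewrite subr_ge0 le_dyadic_psum.
by rewrite sum_exp2V// expr0 invr1; lra.
Qed.

Lemma dyadic_digits_half x : 2^-1 <= x -> x < 1 ->
  dyadic_digits x 0%N = false /\ dyadic_digits x 1%N = true.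
Proof.
move=> x0 x1; have xe : dyadic_expansion x (dyadic_digits x).
  by apply: dyadic_digits_expansion; lra.
have := dyadic_expansion_bounds 0 xe; have := dyadic_expansion_bounds 1 xe.
rewrite dyadic_psumS dyadic_psum0 expr0 expr1.
by case: (dyadic_digits x 0%N) => /=; case: (dyadic_digits x 1%N) => //=; lra.
Qed.

(** The lower bound is termwise, [e_k <= k e_k] for [k >= 1], together with [e_0 = 0]. The upper
    bound depends on [e_1 = 1]. *)
Lemma weighted_digit_sum_bounds x : 2^-1 <= x -> x < 1 ->
  x <= weighted_digit_sum x <= 2 * x.
Proof.
move=> x0 x1; have xe : dyadic_expansion x (dyadic_digits x).
  by apply: dyadic_digits_expansion; lra.
have [e0 e1] := dyadic_digits_half x0 x1.
have limP := dyadic_expansion_cvg_psum xe.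
have limW := @cvg_weighted_psum x.
set e := dyadic_digits x in xe e0 e1 limP limW.
apply/andP; split.
  rewrite -subr_ge0; apply: (cvgr_to_ge (cvgB limW limP)).
  exists 0%N => // n _; rewrite subr_ge0/=; elim: n => [|n IH].
    by rewrite weighted_psum0 dyadic_psum0 e0.
  by rewrite weighted_psumS dyadic_psumS lerD// ler_peMl ?ler1n.
apply: (cvgr_to_le limW); exists 1%N => // -[//|n] _ /=.
(* The subtracted term makes the induction work: equality holds at the start because [e_1 = 1], a
   digit 1 raises both sides equally, and a digit 0 does not lower the right side. *)
have : weighted_psum e n.+1 <=
    2 * dyadic_psum R e n.+1 - n.+1%:R * (2 ^+ n.+1)^-1.
  elim: n => [|n IH].
    rewrite weighted_psumS weighted_psum0 dyadic_psumS dyadic_psum0 e0 e1.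
    by rewrite /= expr1; lra.
  rewrite weighted_psumS [dyadic_psum R e n.+2]dyadic_psumS.
  move: IH; rewrite (exp2VS R n.+1); have := exp2V_gt0 R n.+2.
  move: (weighted_psum _ _) (dyadic_psum _ _ _) (_^-1) => w p t t0.
  have n0 : (0 : R) <= n%:R by rewrite ler0n.
  have nt : 0 <= n%:R * t by rewrite mulr_ge0// ltW.
  rewrite -!natr1.
  by case: (e n.+2) => /=; nra.
have /andP[+ _] := dyadic_expansion_bounds n.+1 xe.
have : 0 <= n.+1%:R * (2 ^+ n.+1 : R)^-1 by rewrite mulr_ge0// ltW// exp2V_gt0.
by lra.
Qed.

Lemma weighted_digit_sum1 : weighted_digit_sum 1 = 0.
Proof.
have xe : dyadic_expansion (1 : R) (dyadic_digits (1 : R)).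
  by apply: dyadic_digits_expansion; lra.
set e := dyadic_digits (1 : R) in xe.
have e0 : dyadic_psum R e 0 = 1.
  have := dyadic_expansion_bounds 0 xe; rewrite dyadic_psum0 expr0.
  by case: (e 0%N) => //=; lra.
have P1 n : dyadic_psum R e n = 1.
  have /andP[+ _] := dyadic_expansion_bounds n xe.
  by have := @le_dyadic_psum R e 0 n isT; rewrite e0; lra.
apply: cvg_lim => //; apply: cvg_near_cst; apply: nearW => n.
by rewrite weighted_psumE big1// => j _; rewrite !P1 subrr.
Qed.

Lemma weighted_digit_sum_half : weighted_digit_sum 2^-1 = 2^-1.
Proof.
have xe : dyadic_expansion (2^-1 : R) (dyadic_digits (2^-1 : R)).
  by apply: dyadic_digits_expansion; lra.
have [e0 e1] : dyadic_digits (2^-1 : R) 0%N = false /\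
    dyadic_digits (2^-1 : R) 1%N = true by apply: dyadic_digits_half; lra.
set e := dyadic_digits (2^-1 : R) in xe e0 e1.
have P1 n : dyadic_psum R e n.+1 = 2^-1.
  have /andP[+ _] := dyadic_expansion_bounds n.+1 xe.
  have := @le_dyadic_psum R e 1 n.+1 isT.
  by rewrite dyadic_psumS dyadic_psum0 e0 e1 expr1 /=; lra.
apply: cvg_lim => //; apply: cvg_near_cst; exists 1%N => // -[//|n] _ /=.
rewrite -/e weighted_psumE big_nat_recl//= dyadic_psum0 e0 P1 subr0.
by rewrite big1 ?addr0// => j _; rewrite !P1 subrr.
Qed.

End WeightedDigitSum.

(* The last hypothesis allows upward jumps only. *)
Lemma ivt_upward_jumps (R : realType) (f : R -> R) (a b c : R) :
  a <= b -> f b <= c <= f a ->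
  (forall eps, 0 < eps -> exists2 d, 0 < d & forall x y,
     a <= x -> x <= y -> y <= b -> y - x < d -> f x - eps <= f y) ->
  exists2 t, a <= t <= b & f t = c.
Proof.
move=> ab /andP[fbc cfa] fmod.
(* The witness is [sup S]. Points just to its right have values below [c], and points of [S] just to
   its left, or [sup S] itself, have values at least [c]; the modulus carries both bounds to [sup S]
   up to [eps]. *)
pose S := [set x | a <= x <= b /\ c <= f x].
have Sa : S a by split=> //; rewrite lexx ab.
have supS : has_sup S by split; [exists a|exists b => x [/andP[]]].
have leS x : S x -> x <= sup S by exact: sup_upper_bound.
have aS : a <= sup S by exact: leS.
have Sb : sup S <= b by apply: ge_sup => [|x [/andP[]]]; first by exists a.
exists (sup S); first by rewrite aS Sb.
apply/eqP; rewrite eq_le; apply/andP; split; apply/ler_addgt0Pr => eps eps0;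
  have [d d0 fd] := fmod _ eps0.
  move: Sb; rewrite le_eqVlt => /predU1P[->|Sb]; first by lra.
  pose y := Num.min b (sup S + d / 2).
  have yb : y <= b by rewrite ge_min lexx.
  have yS : y <= sup S + d / 2 by rewrite ge_min lexx orbT.
  have Sy : sup S < y by rewrite lt_min Sb ltrDl; lra.
  have fyc : f y < c.
    rewrite ltNge; apply/negP => cfy.
    have : S y by split=> //; rewrite yb (le_trans aS (ltW Sy)).
    by move=> /leS; rewrite leNgt Sy.
  by have := fd _ _ aS (ltW Sy) yb; lra.
have [x Sx] := sup_adherent d0 supS; have := leS _ Sx.
case: Sx => /andP[ax _] cfx xS Sdx.
by have := fd _ _ ax xS Sb; lra.
Qed.

(** * The range of [xi] on the interval from 1/2 to 1 *)

Section Range.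
Variable R : realType.
Implicit Types (x y c : R) (m : nat).

Lemma ln2_gt0 : 0 < ln 2 :> R.
Proof. by apply: ln_gt0; rewrite ltr1n. Qed.

(** Apply [ln (1 + u) <= u] to [u = (y - x) / x], where [1 / x <= 2]. *)
Lemma log2B_le x y : 2^-1 <= x -> x <= y -> log2 y - log2 x <= 2 * (y - x) / ln 2.
Proof.
move=> x2 xy; rewrite /log2 -mulrBl ler_pM2r ?invr_gt0 ?ln2_gt0//.
have x0 : 0 < x by lra.
rewrite -ln_div ?posrE//; last by lra.
have -> : y / x = 1 + (y - x) / x by field; rewrite gt_eqF.
have yx0 : 0 <= (y - x) / x by rewrite divr_ge0; lra.
apply: (le_trans (le_ln1Dx _)); first by lra.
rewrite mulrC ler_wpM2r; try lra.
by rewrite -[leRHS]invrK lef_pV2 ?posrE; lra.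
Qed.

Lemma xiE x : xi x = 2 - log2 x - x^-1 * weighted_digit_sum x.
Proof. by []. Qed.

Lemma log2_1 : log2 (1 : R) = 0.
Proof. by rewrite /log2 ln1 mul0r. Qed.

Lemma xi1 : xi (1 : R) = 2.
Proof. by rewrite xiE weighted_digit_sum1 log2_1 mulr0; lra. Qed.

Lemma log2_half : log2 (2^-1 : R) = -1.
Proof. by rewrite /log2 lnV ?posrE// mulNr divff// gt_eqF// ln2_gt0. Qed.

Lemma xi_half : xi (2^-1 : R) = 2.
Proof. by rewrite xiE weighted_digit_sum_half log2_half invrK; lra. Qed.

Lemma xi_bounds x : 2^-1 <= x -> x < 1 -> 0 < xi x <= 2.
Proof.
move=> x2 x1; have x0 : 0 < x by lra.
have /andP[] := weighted_digit_sum_bounds x2 x1.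
rewrite -(ler_pM2l (_ : 0 < x^-1)) ?invr_gt0// mulVf ?gt_eqF// => lo.
rewrite -(ler_pM2l (_ : 0 < x^-1)) ?invr_gt0// mulrCA mulVf ?gt_eqF// => hi.
have : log2 x < 0 by rewrite pmulr_llt0 ?invr_gt0 ?ln2_gt0// ln_lt0// x0.
have : -1 <= log2 x.
  by rewrite -log2_half ler_pM2r ?invr_gt0 ?ln2_gt0// ler_ln ?posrE.
by rewrite xiE; lra.
Qed.

(** With [f] the weighted digit sum, [f y / y - f x / x <= (f y - f x) / x] since [f y >= 0]; the
    factor 2 bounds [1 / x]. *)
Lemma xi_mod x y m : 2^-1 <= x -> x <= y -> y < 1 ->
  xi x - xi y <= 2 * (y - x) / ln 2 + 2 * (m%:R * (y - x) + 2 * (2 ^+ m)^-1).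
Proof.
move=> x2 xy y1.
have [x0 y0 y2] : [/\ 0 < x, 0 < y & y < 2] by split; lra.
have y2' : 2^-1 <= y by lra.
have xV : x^-1 <= 2 by rewrite -[leRHS]invrK lef_pV2 ?posrE; lra.
have yxV : y^-1 <= x^-1 by rewrite lef_pV2 ?posrE.
have wB := weighted_digit_sum_mod m (ltW x0) xy y2.
have /andP[wy _] := weighted_digit_sum_bounds y2' y1.
have B0 : 0 <= m%:R * (y - x) + 2 * (2 ^+ m)^-1.
  by rewrite addr_ge0// mulr_ge0 ?subr_ge0// ltW// exp2V_gt0.
rewrite !xiE; move: wB B0 wy (log2B_le x2 xy).
move: (weighted_digit_sum x) (weighted_digit_sum y) => w v.
move: (2 * (y - x) / ln 2) (m%:R * (y - x) + _) (log2 x) (log2 y) => h B p q.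
move=> wB B0 wy qp; have {}wy : 0 <= v by lra.
have : y^-1 * v <= x^-1 * v by rewrite ler_wpM2r.
have : x^-1 * v - x^-1 * w <= 2 * B.
  rewrite -mulrBr; apply: (@le_trans _ _ (x^-1 * B)).
    by rewrite ler_pM2l ?invr_gt0.
  by rewrite ler_wpM2r.
by lra.
Qed.

(** Shows that [xi] tends to 0 at 1 from the left: the weighted digit sum is close to 2 there, and
    dividing it by [x < 1] only increases it. *)
Lemma xi_mod1 x m : 2^-1 <= x -> x < 1 ->
  xi x <= 2 * (1 - x) / ln 2 + (m%:R * (1 - x) + 2 * (2 ^+ m)^-1).
Proof.
move=> x2 x1; have x0 : 0 < x by lra.
have xV : 1 <= x^-1 by rewrite -invr1 lef_pV2 ?posrE; lra.
have /andP[wx _] := weighted_digit_sum_bounds x2 x1.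
have := weighted_digit_sum_ge m (ltW x0) x1.
have : weighted_digit_sum x <= x^-1 * weighted_digit_sum x.
  by rewrite ler_peMl//; exact: le_trans (ltW x0) wx.
rewrite !xiE; move: (log2B_le x2 (ltW x1)); rewrite log2_1.
move: (weighted_digit_sum x) (log2 x) (_ / ln 2) => w p h {wx}.
by lra.
Qed.

(* xi tends to 0 at 1 from the left, whereas xi 1 = 2 is an upward jump. *)
Definition xi_left x : R := if x == 1 then 0 else xi x.

Lemma xi_left_mod x y m : 2^-1 <= x -> x <= y -> y <= 1 ->
  xi_left x - xi_left y
  <= 2 * (y - x) / ln 2 + 2 * (m%:R * (y - x) + 2 * (2 ^+ m)^-1).
Proof.
move=> x2 xy y1.
have B0 : 0 <= m%:R * (y - x) + 2 * (2 ^+ m)^-1.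
  by rewrite addr_ge0// mulr_ge0 ?subr_ge0// ltW// exp2V_gt0.
have h0 : 0 <= 2 * (y - x) / ln 2.
  by rewrite divr_ge0 ?(ltW ln2_gt0)// mulr_ge0// subr_ge0.
rewrite /xi_left; have [x1|x1] := eqVneq x 1.
  have y1' : y = 1 by lra.
  subst y.
  by rewrite eqxx subrr addr_ge0// mulr_ge0.
have [y1'|y1'] := eqVneq y 1; last by apply: xi_mod => //; rewrite lt_neqAle y1'.
subst y; rewrite subr0.
apply: (le_trans (xi_mod1 m x2 _)); first by rewrite lt_neqAle x1.
by rewrite lerD2l ler_peMl// ler1n.
Qed.

Lemma range_xi_itv : xi @` `[2^-1, 1]%classic = `]0, 2]%classic :> set R.
Proof.
apply/seteqP; split => [_ [x /=] /[!in_itv]/= /andP[x2 x1] <-|c /=].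
  move: x1; rewrite le_eqVlt => /predU1P[->|x1]; last exact: xi_bounds.
  by rewrite xi1; lra.
rewrite !in_itv/= => /andP[c0 c2].
have [|||t] := @ivt_upward_jumps R xi_left 2^-1 1 c.
- by lra.
- rewrite /xi_left eqxx; case: eqP => [|_]; first by lra.
  by rewrite xi_half; lra.
- move=> eps eps0.
  (* The constant term [4 / 2^m] of the modulus takes half of [eps]; the terms linear in [y - x], of
     slope [K], take the other half. *)
  have [m _ mP] : \forall m \near \oo, (2 ^+ m : R)^-1 < eps / 8.
    by apply: cvgr_lt; [exact: cvg_exp2V|lra].
  have := mP m (leqnn m); rewrite /= => {}mP.
  pose K := 2 / ln 2 + 2 * m%:R : R.
  have K0 : 0 < K by rewrite ltr_wpDr ?mulr_ge0// divr_gt0 ?ln2_gt0.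
  exists (eps / 2 / K); first by rewrite !divr_gt0.
  move=> x y x2 xy y1 yx; have := xi_left_mod m x2 xy y1.
  have : K * (y - x) < eps / 2 by rewrite mulrC -ltr_pdivlMr.
  have -> : K * (y - x) = 2 * (y - x) / ln 2 + 2 * (m%:R * (y - x)).
    by rewrite /K; ring.
  move: (xi_left x) (xi_left y) (2 * (y - x) / ln 2) (m%:R * (y - x)) => p q h k.
  by lra.
move=> t21 tc; exists t; first by rewrite /= in_itv.
(* The case [t = 1] would give [c = 0], so [xi_left] and [xi] agree at [t]. *)
move: tc; rewrite /xi_left; case: eqP => // _ ?; lra.
Qed.

End Range.

(** * Finitely supported series and grids on the line *)

Lemma eseries_finite_support (R : realType) (u : nat -> \bar R) n :
  (forall i, 0 <= u i)%E -> (forall i, (n <= i)%N -> u i = 0%E) ->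
  (\sum_(0 <= i <oo) u i = \sum_(0 <= i < n) u i)%E.
Proof.
move=> u0 un; rewrite (nneseries_split 0%N n)// add0n.
by rewrite eseries0 ?adde0// => i ni _; exact: un.
Qed.

Lemma sum_cst_EFin (R : realType) n (r : R) :
  (\sum_(0 <= i < n) r%:E = (n%:R * r)%:E)%E.
Proof. by rewrite sumEFin sumr_const_nat subn0 mulr_natl. Qed.

Lemma natr_gt_ex (R : realType) (r : R) : exists n : nat, r < n%:R.
Proof.
have [r0|r0] := leP 0 r; last by exists 0%N.
by exists (Num.truncn r).+1; have /andP[] := truncn_itv r0.
Qed.

(** Take the least index whose right end reaches [x]; minimality gives the strict left
    inequality. *)
Lemma grid_cell_ex (R : realType) (h x : R) n : 0 < x <= n%:R * h ->
  exists2 i, (i < n)%N & i%:R * h < x <= i.+1%:R * h.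
Proof.
case: n => [|n] /andP[x0 xn]; first by move: xn; rewrite mul0r leNgt x0.
have : exists k, x <= k.+1%:R * h by exists n.
case/ex_minnP => i xi imin; exists i; first exact: imin.
rewrite xi andbT; case: i {xi} imin => [|i] imin; first by rewrite mul0r.
by rewrite ltNge; apply/negP => /imin; rewrite ltnn.
Qed.

(** * Hausdorff dimension of a half-open interval *)

Section HausdorffDimItv.
Variable R : realType.
Implicit Types (s d : R) (U : set R).

Lemma diameter_ge0 U x : U x -> (0 <= diameter U)%E.
Proof.
by move=> Ux; apply: ereal_sup_ubound; exists x => //; exists x => //;
  rewrite subrr normr0.
Qed.

Lemma diameter_pow_ge0 s U : (0 <= diameter_pow s U)%E.
Proof. by rewrite /diameter_pow; case: ifP => // _; exact: poweR_ge0. Qed.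

Lemma diameter_pow0 s : diameter_pow s (set0 : set R) = 0%E.
Proof. by rewrite /diameter_pow eqxx. Qed.

Lemma diameter_itv_le (a b : R) : a <= b -> (diameter `[a, b]%classic <= (b - a)%:E)%E.
Proof.
move=> ab; apply: ge_ereal_sup => _ [x /= xab [y /= yab <-]].
move: xab yab; rewrite !in_itv/= => /andP[ax xb] /andP[ay yb].
by rewrite lee_fin ler_norml; lra.
Qed.

Lemma diameter_pow_itv_le s (a b : R) : 0 <= s -> a <= b ->
  (diameter_pow s `[a, b]%classic <= ((b - a) `^ s)%:E)%E.
Proof.
move=> s0 ab; rewrite /diameter_pow; case: ifP => _; first by rewrite lee_fin powR_ge0.
rewrite -poweR_EFin; apply: gt0_ler_poweR => //; last exact: diameter_itv_le.
  rewrite in_itv/= leey andbT; apply: (@diameter_ge0 _ a).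
  by rewrite /= in_itv/= lexx.
by rewrite in_itv/= leey andbT lee_fin subr_ge0.
Qed.

Lemma hausdorff_premeasure_ge0 s d (F : set R) : (0 <= hausdorff_premeasure s d F)%E.
Proof.
apply: le_ereal_inf_tmp => _ [U _ <-].
by apply: nneseries_ge0 => n _ _; exact: diameter_pow_ge0.
Qed.

(** The cover consists of [n.+1] closed cells of equal length, padded with empty sets of weight
    0. *)
Lemma hausdorff_premeasure_itv_le s d (b : R) n : 0 <= s -> 0 <= b ->
  b / n.+1%:R <= d ->
  (hausdorff_premeasure s d `]0%R, b]%classic
    <= (n.+1%:R * (b / n.+1%:R) `^ s)%:E)%E.
Proof.
move=> s0 b0; set h := b / n.+1%:R => hd; have h0 : 0 <= h by rewrite divr_ge0.
have hS i : i%:R * h <= i.+1%:R * h by rewrite -natr1 mulrDl; lra.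
have hB i : i.+1%:R * h - i%:R * h = h by rewrite -natr1 mulrDl; lra.
pose U i : set R := if (i < n.+1)%N then `[i%:R * h, i.+1%:R * h]%classic else set0.
apply: (@le_trans _ _ (\sum_(0 <= i <oo) diameter_pow s (U i))%E).
  apply: ereal_inf_lbound; exists U => //; split.
    move=> x /=; rewrite in_itv/= => /andP[x0 xb].
    have bh : b = n.+1%:R * h by rewrite /h mulrC divfK// pnatr_eq0.
    have [|i ni xi] := @grid_cell_ex _ h x n.+1; first by rewrite x0 -bh.
    exists i => //; rewrite /U ni /= in_itv/=.
    by have /andP[/ltW -> ->] := xi.
  move=> i; rewrite /U; case: ifP => _.
    by apply: (le_trans (diameter_itv_le (hS i))); rewrite hB lee_fin.
  by apply: ge_ereal_sup => _ [x []].
rewrite (@eseries_finite_support _ _ n.+1); first last.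
- by move=> i ni; rewrite /U ltnNge ni /= diameter_pow0.
- by move=> i; exact: diameter_pow_ge0.
rewrite -sum_cst_EFin !big_mkord; apply: lee_sum => i _.
rewrite /U ltn_ord; apply: (le_trans (diameter_pow_itv_le s0 (hS i))).
by rewrite hB.
Qed.

Lemma hausdorff_measure_itv_eq0 s (b : R) : 1 < s -> 0 < b ->
  hausdorff_measure s `]0, b]%classic = 0%E.
Proof.
move=> s1 b0; apply/eqP; rewrite eq_le; apply/andP; split; last first.
  apply: (le_trans (hausdorff_premeasure_ge0 s 1 _)).
  by apply: ereal_sup_ubound; exists 1 => //=.
apply: ge_ereal_sup => _ [d /= d0 <-].
apply/lee_addgt0Pr => eps eps0; rewrite add0e.
(* Cells of length [h] have total weight [b * h^(s - 1)], which equals [eps] at [h = t]; the grid is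
   taken finer than both [t] and [d]. *)
pose t := (eps / b) `^ (s - 1)^-1.
have t0 : 0 < t by apply: powR_gt0; exact: divr_gt0.
pose m := Num.min d t.
have m0 : 0 < m by rewrite lt_min d0 t0.
have [[|n] nP] := natr_gt_ex (b / m).
  by move: nP; rewrite ltNge divr_ge0// ltW.
have n0 : (0 : R) < n.+1%:R by rewrite ltr0n.
have hm : b / n.+1%:R < m by rewrite ltr_pdivrMr// mulrC -ltr_pdivrMr.
have hd : b / n.+1%:R <= d by apply: (le_trans (ltW hm)); rewrite ge_min lexx.
have ht : b / n.+1%:R <= t by apply: (le_trans (ltW hm)); rewrite ge_min lexx orbT.
have s0 : 0 <= s by lra.
apply: (le_trans (hausdorff_premeasure_itv_le s0 (ltW b0) hd)).
have h0 : 0 < b / n.+1%:R by rewrite divr_gt0.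
rewrite lee_fin -(mulr_powRB1 (ltW h0)); last by lra.
have -> (q : R) : n.+1%:R * (b / n.+1%:R * q) = b * q.
  by field; rewrite gt_eqF.
rewrite mulrC -ler_pdivlMr//.
have -> : eps / b = t `^ (s - 1).
  rewrite /t -powRrM mulVf ?powRr1//; last by rewrite gt_eqF// subr_gt0.
  by rewrite divr_ge0// ltW.
have s10 : 0 <= s - 1 by lra.
by apply: ge0_ler_powR => //; rewrite nnegrE ltW.
Qed.

(* An arbitrary U lies in an interval of twice its diameter, which suffices
   up to a factor 2 to compare with Lebesgue measure. *)
Lemma diameter_pow_hull s U : 0 <= s <= 1 -> (diameter U <= 1%:E)%E ->
  exists B : set R, [/\ measurable B, U `<=` B &
    (lebesgue_measure B <= 2%:E * diameter_pow s U)%E].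
Proof.
move=> /andP[s0 s1] U1.
have [->|/set0P[x Ux]] := eqVneq U set0.
  by exists set0; split => //; rewrite measure0 diameter_pow0 mule0.
have U0 := diameter_ge0 Ux.
have [d dE] : exists d, diameter U = d%:E.
  by case: (diameter U) U0 U1 => [d| |] // _ _; exists d.
rewrite dE !lee_fin in U0 U1.
exists `[x - d, x + d]%classic; split => //.
  move=> y Uy /=; rewrite in_itv/=.
  have : (`|x - y|%:E <= diameter U)%E.
    by apply: ereal_sup_ubound; exists x => //; exists y.
  by rewrite dE lee_fin ler_norml => /andP[? ?]; apply/andP; split; lra.
rewrite lebesgue_measure_itv /diameter_pow; case: ifPn => [|_].
  rewrite ifF; last by apply/negbTE/set0P; exists x.
  rewrite /= lte_fin => dd; rewrite dE poweR_EFin -EFinB -EFinM lee_fin.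
  have -> : x + d - (x - d) = 2 * d by ring.
  (* Here [d <= 1] and [s <= 1] give [d <= d^s], whence the diameter bound 1. *)
  rewrite ler_pM2l//; apply: ger1_powR => //; lra.
by rewrite mule_ge0//; exact: diameter_pow_ge0.
Qed.

(** Mass distribution: the measurable hulls of a cover have total Lebesgue measure at least [b], and
    each costs at most twice the weight of its set. *)
Lemma hausdorff_premeasure_ge s (b : R) : 0 <= s <= 1 -> 0 < b ->
  ((b / 2)%:E <= hausdorff_premeasure s 1 `]0%R, b]%classic)%E.
Proof.
move=> s01 b0; apply: le_ereal_inf_tmp => _ [U [FU U1] <-].
have [B HB] := choice (fun i => diameter_pow_hull s01 (U1 i)).
have : (lebesgue_measure `]0%R, b]%classic <=
    \sum_(0 <= i <oo) lebesgue_measure (B i))%E.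
  apply: measure_sigma_subadditive => //.
    by move=> i; have [] := HB i.
  by move=> x /FU [i _ Uix]; exists i => //; have [_ + _] := HB i; exact.
rewrite lebesgue_measure_itv /= lte_fin b0 -EFinB subr0 => bB.
have : (b%:E <= 2%:E * \sum_(0 <= i <oo) diameter_pow s (U i))%E.
  apply: (le_trans bB); rewrite -nneseriesZl; last first.
    by move=> i _; exact: diameter_pow_ge0.
  by apply: lee_nneseries => // i _; have [] := HB i.
by rewrite mulrC EFinM lee_pdivrMl.
Qed.

Lemma hausdorff_dim_itv (b : R) : 0 < b ->
  hausdorff_dim (`]0, b]%classic : set R) = 1%E.
Proof.
move=> b0; apply/eqP; rewrite eq_le; apply/andP; split.
  apply/lee_addgt0Pr => eps eps0; apply: ereal_inf_lbound.
  exists (1 + eps); last by rewrite EFinD.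
  by split; [lra|apply: hausdorff_measure_itv_eq0 => //; lra].
(* An exponent [s < 1] of measure zero would contradict the positive premeasure at scale 1. *)
apply: le_ereal_inf_tmp => _ [s [s0 Hs] <-]; rewrite lee_fin leNgt; apply/negP => s1.
have s01 : 0 <= s <= 1 by lra.
have : ((b / 2)%:E <= 0)%E.
  rewrite -Hs; apply: (le_trans (hausdorff_premeasure_ge s01 b0)).
  by apply: ereal_sup_ubound; exists 1 => //=.
by rewrite lee_fin leNgt divr_gt0.
Qed.

End HausdorffDimItv.

(** * Box-counting dimension of a half-open interval *)

Section BoxDimItv.
Variable R : realType.
Implicit Types (d b : R) (n : nat).

Lemma ball_coverable_itv d b n : 0 < d -> b <= n%:R * (2 * d) ->
  ball_coverable (`]0, b]%classic : set R) d n.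
Proof.
(* The centres are the midpoints of the grid cells of length [2 * d]. *)
move=> d0 bn; exists (fun i => (2 * i%:R + 1) * d) => x /=.
rewrite in_itv/= => /andP[x0 xb].
have [|i ni /andP[ix xi]] := @grid_cell_ex _ (2 * d) x n.
  by rewrite x0 (le_trans xb).
exists i => //; rewrite closed_ballE// /closed_ball_/= ler_norml.
by rewrite -natr1 in xi; apply/andP; split; lra.
Qed.

(** Lebesgue measure is subadditive, and each of the [n] balls has length [2 * d]. *)
Lemma ball_coverable_itv_ge d b n : 0 < d -> 0 < b ->
  ball_coverable (`]0, b]%classic : set R) d n -> b <= n%:R * (2 * d).
Proof.
move=> d0 b0 [c cF].
pose B i : set R := if (i < n)%N then closed_ball (c i) d else set0.
have : (lebesgue_measure `]0%R, b]%classic <=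
    \sum_(0 <= i <oo) lebesgue_measure (B i))%E.
  apply: measure_sigma_subadditive => //.
    by move=> i; rewrite /B; case: ifP => // _; exact: measurable_realfun.measurable_closed_ball.
  by move=> x /cF [i /= ni xi]; exists i => //; rewrite /B ni.
rewrite lebesgue_measure_itv /= lte_fin b0 -EFinB subr0.
rewrite (@eseries_finite_support _ _ n)//; last first.
  by move=> i ni; rewrite /B ltnNge ni /= measure0.
have -> : (\sum_(0 <= i < n) lebesgue_measure (B i) =
    \sum_(0 <= i < n) (d *+ 2)%:E)%E.
  rewrite !big_mkord; apply: eq_bigr => i _.
  by rewrite /B ltn_ord lebesgue_measure_closed_ball// ltW.
by rewrite sum_cst_EFin lee_fin -(mulr_natl d).
Qed.

Lemma covering_number_itv_bounds d b : 0 < d -> 0 < b ->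
  b / (2 * d) <= covering_number (`]0, b]%classic : set R) d
  <= b / (2 * d) + 1.
Proof.
move=> d0 b0; set q := b / (2 * d).
have q0 : 0 <= q by rewrite divr_ge0 ?mulr_ge0// ltW.
have /andP[qn nq] := truncn_itv q0.
have bq : b = q * (2 * d) by rewrite /q divfK// mulf_neq0// gt_eqF.
pose N := (Num.truncn q).+1.
have NF : ball_coverable (`]0, b]%classic : set R) d N.
  by apply: ball_coverable_itv => //; rewrite bq ler_pM2r ?mulr_gt0// ltW.
have lbq : lbound [set n%:R | n in ball_coverable (`]0, b]%classic : set R) d] q.
  move=> _ [n nF <-]; rewrite ler_pdivrMr ?mulr_gt0//.
  exact: ball_coverable_itv_ge.
apply/andP; split; first by apply: lb_le_inf => //; exists N%:R; exists N.
apply: (@le_trans _ _ N%:R); last by rewrite -natr1 lerD2r.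
by apply: ge_inf; [exists q|exists N].
Qed.

Lemma has_box_dim_itv b : 0 < b -> has_box_dim (`]0, b]%classic : set R) 1.
Proof.
move=> b0; split.
  exists b; split; first exact: num_real.
  move=> M bM x /=; rewrite in_itv/= => /andP[x0 xb].
  by rewrite gtr0_norm// (le_trans xb)// ltW.
(* [C] bounds the distance from [ln N] to [- ln d] for [d < 1], so the quotient differs from 1 by at
   most [C / - ln d]. *)
pose C := `|ln (b / 2)| + `|ln (b / 2 + 1)|.
have lnN : - ln d @[d --> (0 : R)^'+] --> +oo by apply/cvgNry; exact: lnNy.
apply/cvgrPdist_lt => eps eps0.
near=> d.
have d0 : 0 < d by near: d; exact: nbhs_right_gt.
have d1 : d < 1 by near: d; apply: nbhs_right_lt.
have lnd : C / eps < - ln d.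
  by near: d; move/cvgryPgt : lnN; apply.
have C0 : 0 <= C by rewrite addr_ge0.
have l0 : 0 < - ln d by apply: le_lt_trans lnd; rewrite divr_ge0// ltW.
have dV1 : 1 < d^-1 by rewrite invf_gt1.
have /andP[] := covering_number_itv_bounds d0 b0.
set N := covering_number _ _ => lN uN.
have b20 : 0 < b / 2 by lra.
have lN' : b / 2 / d <= N by move: lN; rewrite invfM mulrA.
have q0 : 0 < b / 2 / d by rewrite divr_gt0.
have N0 : 0 < N by exact: lt_le_trans lN'.
(* Since [d < 1], the additive 1 is absorbed into [1 / d]. *)
have uN' : N <= (b / 2 + 1) / d.
  by apply: (le_trans uN); rewrite [leRHS]mulrDl mul1r invfM mulrA lerD2l ltW.
have lnl : ln (b / 2) - ln d <= ln N.
  by rewrite -ln_div ?posrE// ler_ln ?posrE.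
have lnu : ln N <= ln (b / 2 + 1) - ln d.
  by rewrite -ln_div ?posrE//; [rewrite ler_ln ?posrE ?divr_gt0//; lra|lra].
have -> : 1 - ln N / - ln d = (- ln d - ln N) / - ln d.
  by rewrite [RHS]mulrBl divff// gt_eqF.
rewrite normrM normfV (gtr0_norm l0) ltr_pdivrMr//.
move: lnd; rewrite ltr_pdivrMr// mulrC; apply: le_lt_trans.
rewrite /C ler_norml.
have := ler_norm (ln (b / 2 + 1)); have := ler_norm (- ln (b / 2)).
rewrite normrN; have := normr_ge0 (ln (b / 2)); have := normr_ge0 (ln (b / 2 + 1)).
move: lnl lnu; clear.
move: (ln N) (ln d) (ln (b / 2)) (ln (b / 2 + 1)) => n l p q.
move: `|p| `|q| => p' q' *.
by apply/andP; split; lra.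
Unshelve. all: by end_near.
Qed.

End BoxDimItv.

Theorem mainTheorem7 (R : realType) :
  let range_xi : set R := xi @` `[2^-1, 1]%classic in
  range_xi = `]0, 2]%classic
  /\ hausdorff_dim range_xi = 1%E
  /\ has_box_dim range_xi 1.
Proof.
rewrite /= range_xi_itv; split; first by [].
by split; [exact: hausdorff_dim_itv|exact: has_box_dim_itv].
Qed.
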